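(* Let $\Gamma$ be a graph containing no induced subgraph isomorphic to the four-cycle $C_4$. Then the graph group $G(\Gamma)$ does not satisfy $\phi(C_4)$; that is, there is no function $\sigma : V(C_4) \to G(\Gamma)$ such that for all $u, v \in V(C_4)$, $u$ and $v$ are adjacent in $C_4$ if and only if $\sigma(u)$ and $\sigma(v)$ commute in $G(\Gamma)$.
   Context: A graph $\Gamma$ is a set $V(\Gamma)$ of vertices together with a reflexive, symmetric relation $E(\Gamma) \subseteq V(\Gamma) \times V(\Gamma)$; vertices $u,v$ are adjacent if $(u,v) \in E(\Gamma)$ (so each vertex is adjacent to itself). The subgraph induced by $S \subseteq V(\Gamma)$ has vertex set $S$ and edge set $E(\Gamma) \cap (S \times S)$. The graph group (right-angled Artin group) $G(\Gamma)$ is the group with presentation $\langle V(\Gamma) \mid ab = ba \text{ for all } (a,b) \in E(\Gamma) \rangle$. $C_4$ is the four-cycle: four vertices $v_1, v_2, v_3, v_4$ where, among pairs of distinct vertices, exactly $\{v_1,v_2\}, \{v_2,v_3\}, \{v_3,v_4\}, \{v_4,v_1\}$ are adjacent. For a graph $\Omega$, a group $G$ satisfies $\phi(\Omega)$ if there is a function $\sigma : V(\Omega) \to G$ such that $u, v \in V(\Omega)$ are adjacent if and only if $\sigma(u)$ and $\sigma(v)$ commute. *)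

(* Defs.v *)
From HB Require Import structures.
From mathcomp Require Import all_boot.
From mathcomp Require Import boolp classical_sets.

Set Implicit Arguments.
Unset Strict Implicit.
Unset Printing Implicit Defensive.

Local Open Scope group_scope.
Local Open Scope quotient_scope.

Record graph := Graph {
  vertex :> Type;
  adj : vertex -> vertex -> Prop;
  adj_refl : forall u, adj u u;
  adj_sym : forall u v, adj u v -> adj v u
}.

Definition graph_iso (A B : graph) : Prop :=
  exists2 f : A -> B, bijective f & forall u v, adj u v <-> adj (f u) (f v).

Section Induced.
Variables (A : graph) (S : set A).

Let induced_adj (u v : {x : A | S x}) : Prop := adj (sval u) (sval v).

Fact induced_adj_refl u : induced_adj u u.
Proof. exact: adj_refl. Qed.

Fact induced_adj_sym u v : induced_adj u v -> induced_adj v u.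
Proof. exact: adj_sym. Qed.

Definition induced : graph := Graph induced_adj_refl induced_adj_sym.
End Induced.

Section FourCycle.
(* [ordS i] is the cyclic successor of [i] in ['I_4]. *)
Let C4_adj (i j : 'I_4) : Prop := [|| i == j, ordS i == j | ordS j == i].

Fact C4_adj_refl i : C4_adj i i.
Proof. by rewrite /C4_adj eqxx. Qed.

Fact C4_adj_sym i j : C4_adj i j -> C4_adj j i.
Proof. by rewrite /C4_adj eq_sym (orbC (ordS i == j)). Qed.

Definition C4 : graph := Graph C4_adj_refl C4_adj_sym.
End FourCycle.

(* The letter [(x, false)] stands for the generator [x], and [(x, true)] for
   its formal inverse. *)
Definition word (X : Type) := seq (X * bool).

Definition inv_word X (w : word X) : word X := rev [seq (l.1, ~~ l.2) | l <- w].

(* Group presentations <X | r = s for all r, s with R r s>: [pres_eq R] is the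
   least congruence on words containing R and free cancellation. *)
Inductive pres_eq (X : Type) (R : word X -> word X -> Prop) :
    word X -> word X -> Prop :=
| PresRefl w : pres_eq R w w
| PresSym u v : pres_eq R u v -> pres_eq R v u
| PresTrans v u w : pres_eq R u v -> pres_eq R v w -> pres_eq R u w
| PresCat u u' v v' :
    pres_eq R u u' -> pres_eq R v v' -> pres_eq R (u ++ v) (u' ++ v')
| PresCancel x b : pres_eq R [:: (x, b); (x, ~~ b)] [::]
| PresRel r s : R r s -> pres_eq R r s.

Section PresentedGroup.
Variables (X : Type) (R : word X -> word X -> Prop).

Definition pres_eqb : rel {classic word X} := fun u v => `[< pres_eq R u v >].

Fact pres_eqb_equiv : equiv_class_of pres_eqb.
Proof.
split=> [u|u v|v u w]; rewrite /pres_eqb.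
- exact/asboolP/PresRefl.
- by apply: asbool_equiv_eq; split; apply: PresSym.
- by move=> /asboolP uv /asboolP vw; apply/asboolP/(PresTrans uv vw).
Qed.

Canonical pres_eqb_equiv_rel := EquivRelPack pres_eqb_equiv.

Definition presented := {eq_quot pres_eqb}.
HB.instance Definition _ := Choice.on presented.
HB.instance Definition _ := Quotient.on presented.

Definition pres_class (w : word X) : presented := \pi_presented w.

Lemma pres_classP u v : pres_class u = pres_class v <-> pres_eq R u v.
Proof. by split=> [/eqmodP/asboolP|uv]//; apply/eqmodP/asboolP. Qed.

Lemma pres_class_surj (a : presented) : exists w, a = pres_class w.
Proof. by exists (repr a); rewrite /pres_class reprK. Qed.

Lemma pres_eq_repr w : pres_eq R (repr (pres_class w)) w.
Proof. by apply/pres_classP; rewrite /pres_class reprK. Qed.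

Lemma inv_word_cat (u v : word X) : inv_word (u ++ v) = inv_word v ++ inv_word u.
Proof. by rewrite /inv_word map_cat rev_cat. Qed.

Lemma inv_wordK : involutive (@inv_word X).
Proof.
move=> w; rewrite /inv_word map_rev revK -map_comp -[RHS]map_id.
by apply: eq_map => -[x b] /=; rewrite negbK.
Qed.

Lemma pres_eq_catV w : pres_eq R (w ++ inv_word w) [::].
Proof.
elim: w => [|[x b] w IHw]; first exact: PresRefl.
rewrite -cat1s inv_word_cat -catA (catA w).
apply: PresTrans (PresCancel R x b); apply: (@PresCat _ R [:: _] [:: _]).
  exact: PresRefl.
exact: (PresCat IHw (PresRefl R _)).
Qed.

Lemma pres_eq_catVl w : pres_eq R (inv_word w ++ w) [::].
Proof. by rewrite -{2}(inv_wordK w); apply: pres_eq_catV. Qed.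

Definition pres_mul (a b : presented) := pres_class (repr a ++ repr b).
Definition pres_inv (a : presented) := pres_class (inv_word (repr a)).

Lemma pres_mulE u v : pres_mul (pres_class u) (pres_class v) = pres_class (u ++ v).
Proof. by apply/pres_classP/PresCat; apply: pres_eq_repr. Qed.

Fact pres_mulA : associative pres_mul.
Proof.
move=> a b c; have [[u ->] [v ->] [w ->]] :=
  And3 (pres_class_surj a) (pres_class_surj b) (pres_class_surj c).
by rewrite !pres_mulE catA.
Qed.

Fact pres_mul1 : left_id (pres_class [::]) pres_mul.
Proof. by move=> a; have [u ->] := pres_class_surj a; rewrite pres_mulE. Qed.

Fact pres_mulr1 : right_id (pres_class [::]) pres_mul.
Proof. by move=> a; have [u ->] := pres_class_surj a; rewrite pres_mulE cats0. Qed.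

Fact pres_mulV : left_inverse (pres_class [::]) pres_inv pres_mul.
Proof.
move=> a; rewrite -{2}[a]reprK -/(pres_class _) pres_mulE.
exact/pres_classP/pres_eq_catVl.
Qed.

Fact pres_mulrV : right_inverse (pres_class [::]) pres_inv pres_mul.
Proof.
move=> a; rewrite -{1}[a]reprK -/(pres_class _) pres_mulE.
exact/pres_classP/pres_eq_catV.
Qed.

HB.instance Definition _ := isGroup.Build presented
  pres_mulA pres_mul1 pres_mulr1 pres_mulV pres_mulrV.

Lemma pres_classM u v : pres_class u * pres_class v = pres_class (u ++ v).
Proof. exact: pres_mulE. Qed.

Definition pres_gen (x : X) : presented := pres_class [:: (x, false)].

Definition eval_word (H : groupType) (f : X -> H) (w : word X) : H :=
  \prod_(l <- w) (if l.2 then (f l.1)^-1 else f l.1).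

Lemma eval_word_gen w : eval_word pres_gen w = pres_class w.
Proof.
rewrite /eval_word; elim: w => [|[x b] w IHw]; first by rewrite big_nil.
rewrite big_cons IHw -[RHS](pres_classM [:: (x, b)]); congr (_ * _).
case: b => //=; apply: (mulIg (pres_gen x)); rewrite mulVg pres_classM.
exact/esym/pres_classP/(PresCancel R x true).
Qed.

Lemma pres_genP r s : R r s -> eval_word pres_gen r = eval_word pres_gen s.
Proof. by move=> Rrs; rewrite !eval_word_gen; apply/pres_classP/PresRel. Qed.

Lemma pres_universal (H : groupType) (f : X -> H) :
    (forall r s, R r s -> eval_word f r = eval_word f s) ->
  exists! g : presented -> H,
    {morph g : a b / a * b} /\ forall x, g (pres_gen x) = f x.
Proof.
move=> fR; have fE u v : pres_eq R u v -> eval_word f u = eval_word f v.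
  elim=> {u v} [//|u v _ ->//|v u w _ -> _ ->//|u u' v v' _ Eu _ Ev|x b|//].
    by rewrite /eval_word !big_cat; congr (_ * _).
  by rewrite /eval_word !big_cons big_nil mulg1; case: b; rewrite ?mulVg ?mulgV.
have gE w : eval_word f (repr (pres_class w)) = eval_word f w.
  exact/fE/pres_eq_repr.
exists (fun a => eval_word f (repr a)); split; first split.
- move=> a b; have [[u ->] [v ->]] := conj (pres_class_surj a) (pres_class_surj b).
  by rewrite pres_classM !gE /eval_word big_cat.
- by move=> x; rewrite gE /eval_word big_seq1.
move=> g [gM gX]; apply: funext => a; have [w ->] := pres_class_surj a.
have g1 : g 1 = 1 by apply: (mulgI (g 1)); rewrite -gM !mulg1.
rewrite gE -eval_word_gen /eval_word (big_morph g gM g1).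
apply: eq_bigr => -[x []] _ /=; rewrite ?gX//.
by apply: (mulIg (f x)); rewrite mulVg -[in RHS]gX -gM mulVg.
Qed.

End PresentedGroup.

Inductive commutation_relator (A : graph) : word A -> word A -> Prop :=
| CommutationRelator (a b : A) : adj a b ->
    commutation_relator [:: (a, false); (b, false)] [:: (b, false); (a, false)].

Definition graph_group (A : graph) : groupType :=
  presented (@commutation_relator A).

Definition satisfies_phi (Omega : graph) (G : groupType) : Prop :=
  exists sigma : Omega -> G,
    forall u v : Omega, adj u v <-> commute (sigma u) (sigma v).

(* Main.v *)
(* For a set S of vertices let retr S be the endomorphism of G = G(Gamma) killing
   the generators outside S, and let v be a vertex.  Key fact: if g <> 1 is
   killed by removing v and commutes with b and d, then [b, d] is conjugate into
   the subgroup generated by the link of v.  Indeed the kernel of removing v is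
   free on the conjugates of v, G acts on the corresponding tree with edge
   stabilizers conjugate to that subgroup, g is hyperbolic, and b and d translate
   its axis, so that [b, d] fixes part of it pointwise.

   Given a, b, c, d realizing C4, replace them by their images under a retraction
   onto a minimal vertex set T for which g = [a, c] and h = [b, d] remain
   nontrivial; every vertex of T then kills g or h when removed.  By the key
   fact, a vertex killing g is adjacent to every vertex killing h.  Moreover h is
   conjugate to its image after removing all vertices killing g, and this image
   is a nontrivial commutator: so two nonadjacent vertices kill h.  Likewise two
   nonadjacent vertices kill g, and these four vertices induce C4. *)

From HB Require Import structures.
Require Import Defs.
From mathcomp Require Import all_boot zify.
From mathcomp Require Import boolp classical_sets.

Set Implicit Arguments.
Unset Strict Implicit.
Unset Printing Implicit Defensive.

Local Open Scope classical_set_scope.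
Local Open Scope group_scope.

(** * Reduced words and free cancellation *)

Section ReducedWords.
Variable Y : eqType.
Implicit Types (l : Y * bool) (s t : word Y).

Definition linv l := (l.1, ~~ l.2).
Definition reduced s := sorted (fun l l' => l' != linv l) s.
Definition push l s :=
  if s is l' :: s' then if l' == linv l then s' else l :: s else [:: l].

Lemma linvK : involutive linv.
Proof. by case=> x b; rewrite /linv /= negbK. Qed.

Lemma inv_word_cons l s : inv_word (l :: s) = rcons (inv_word s) (linv l).
Proof. by rewrite /inv_word /= rev_cons. Qed.

Lemma inv_word_rcons l s : inv_word (rcons s l) = linv l :: inv_word s.
Proof. by rewrite /inv_word map_rcons rev_rcons. Qed.

Lemma size_inv_word s : size (inv_word s) = size s.
Proof. by rewrite /inv_word size_rev size_map. Qed.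

Lemma reduced_catl s t : reduced (s ++ t) -> reduced s.
Proof. by case: s => //= l s; rewrite /reduced /= cat_path => /andP[]. Qed.

Lemma reduced_catr s t : reduced (s ++ t) -> reduced t.
Proof.
case: s => //= l s; rewrite /reduced /= cat_path => /andP[_].
exact: path_sorted.
Qed.

Lemma reduced_push l s : reduced s -> reduced (push l s).
Proof.
case: s => //= l' s rs; case: eqP => [_|/eqP nl]; first exact: path_sorted rs.
by rewrite /reduced /= nl.
Qed.

Lemma push_cons l s : reduced (l :: s) -> push l s = l :: s.
Proof. by case: s => //= l' s; rewrite /reduced /= => /andP[/negPf ->]. Qed.

Lemma pushK l s : reduced s -> push (linv l) (push l s) = s.
Proof.
case: s => [|l' s] rs /=; first by rewrite linvK eqxx.
case: eqP => [El|_] /=; last by rewrite linvK eqxx.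
by rewrite -El; apply: push_cons.
Qed.

(** Induction peels off the last letter of [s] as long as it cancels the first letter of [t]; the
    first pair that does not cancel makes the remaining concatenation reduced. *)
Lemma reduced_cancel s t : reduced s -> reduced t ->
  exists u c v, [/\ s = u ++ c, t = inv_word c ++ v & reduced (u ++ v)].
Proof.
elim/last_ind: s t => [|s l IHs] t rs rt; first by exists [::], [::], t.
case: t rt => [|l' t] rt.
  by exists (rcons s l), [::], [::]; rewrite !cats0.
have [El|nl] := eqVneq l' (linv l).
  have rs' : reduced s by move: rs; rewrite -cats1; apply: reduced_catl.
  have [u [c [v [-> -> ruv]]]] := IHs t rs' (path_sorted rt).
  by exists u, (rcons c l), v; rewrite inv_word_rcons El rcons_cat.
exists (rcons s l), [::], (l' :: t); split=> //; first by rewrite cats0.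
case: s rs {IHs} => [|x s]; first by rewrite /reduced /= nl.
by rewrite /reduced /= => rs; rewrite cat_path rs last_rcons /= nl.
Qed.

End ReducedWords.

Definition lmap (Y Z : Type) (f : Y -> Z) (l : Y * bool) := (f l.1, l.2).

Section LetterMap.
Variables (Y : eqType) (f : Y -> Y).
Hypothesis f_inj : injective f.

Lemma lmap_inj : injective (lmap f).
Proof. by case=> x b [y c] [/f_inj -> ->]. Qed.

Lemma lmap_push l s :
  map (lmap f) (push l s) = push (lmap f l) (map (lmap f) s).
Proof.
case: s => //= l' s; have -> : linv (lmap f l) = lmap f (linv l) by [].
by rewrite (inj_eq lmap_inj); case: ifP.
Qed.

Lemma lmap_reduced s : reduced (map (lmap f) s) = reduced s.
Proof.
rewrite /reduced sorted_map; apply: eq_sorted => l1 l2 /=.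
by rewrite -[in RHS](inj_eq lmap_inj).
Qed.

End LetterMap.

(** * Retractions onto subgroups generated by vertex sets *)

Section GraphGroup.
Variable Gamma : graph.
Notation G := (graph_group Gamma).
Implicit Types (S T : set Gamma) (x y : G).

Definition gen (u : Gamma) : G := pres_gen (@commutation_relator Gamma) u.
Definition sgen u b : G := if b then (gen u)^-1 else gen u.

Lemma sgenN u b : sgen u b * sgen u (~~ b) = 1.
Proof. by case: b; rewrite /= ?mulgV ?mulVg. Qed.

Lemma eval_gen w : eval_word gen w = pres_class _ w :> G.
Proof. exact: eval_word_gen. Qed.

Lemma graph_group_ind (P : G -> Prop) :
  P 1 -> (forall u b x, P x -> P (sgen u b * x)) -> forall x, P x.
Proof.
move=> P1 PM x; have [w ->] := pres_class_surj x; rewrite -eval_gen.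
elim: w => [|[u b] w IHw]; rewrite /eval_word ?big_nil// big_cons.
exact: PM.
Qed.

Lemma gen_comm u v : adj u v -> commute (gen u) (gen v).
Proof.
move=> uv; have := pres_genP (CommutationRelator uv).
by rewrite /eval_word !big_cons !big_nil /= !mulg1.
Qed.

Lemma retr_exists S : exists f : G -> G, {morph f : x y / x * y} /\
  forall u, f (gen u) = if `[< S u >] then gen u else 1.
Proof.
pose f u := if `[< S u >] then gen u else 1 : G.
have [|g [gP _]] := @pres_universal _ (@commutation_relator Gamma) _ f.
  2: by exists g.
move=> _ _ [a b ab]; rewrite /eval_word !big_cons !big_nil /= !mulg1 /f.
by do 2![case: ifP => _]; rewrite ?mulg1 ?mul1g//; apply: gen_comm.
Qed.

Definition retr S : G -> G := sval (cid (retr_exists S)).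

Lemma retrM S : {morph retr S : x y / x * y}.
Proof. by rewrite /retr; case: cid => f []. Qed.

Lemma retr_gen S u : retr S (gen u) = if `[< S u >] then gen u else 1.
Proof. by rewrite /retr; case: cid => f []. Qed.

Lemma retr1 S : retr S 1 = 1.
Proof. by apply: (mulgI (retr S 1)); rewrite -retrM !mulg1. Qed.

HB.instance Definition _ S :=
  isMultiplicative.Build G G (retr S) (retrM S).
HB.instance Definition _ S :=
  Multiplicative_isUMagmaMorphism.Build G G (retr S) (retr1 S).

Lemma retr_sgen S u b : retr S (sgen u b) = if `[< S u >] then sgen u b else 1.
Proof.
case: b => /=; last exact: retr_gen.
by rewrite gmulfV /= retr_gen; case: ifP => // _; rewrite invg1.
Qed.

Lemma retr_retr S T x : retr S (retr T x) = retr (S `&` T) x.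
Proof.
elim/graph_group_ind: x => [|u b x IHx]; first by rewrite !gmulf1.
rewrite !gmulfM /= IHx !retr_sgen; congr (_ * _); rewrite asbool_and.
by case: ifP => _; rewrite ?gmulf1 ?andbF// retr_sgen andbT.
Qed.

Lemma retr_sub S T x : S `<=` T -> retr S x = x -> retr T x = x.
Proof. by move=> ST <-; rewrite retr_retr (setIidr ST). Qed.

(** Since [Gamma] may be infinite, this is what allows a minimal vertex set to be found by induction
    on a list. *)
Lemma finite_support x : exists s : seq Gamma, retr (fun u => List.In u s) x = x.
Proof.
elim/graph_group_ind: x => [|u b x [s IHs]]; first by exists [::]; rewrite gmulf1.
exists (u :: s); rewrite gmulfM /= retr_sgen asboolT /=; last by left.
by congr (_ * _); apply: retr_sub IHs => v; right.
Qed.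

(** The subgroup generated by [S], encoded as the fixed points of the idempotent [retr S], so that
    membership is an equation. *)
Definition parabolic S : set G := [set x | retr S x = x].

Lemma parabolic1 S : parabolic S 1.
Proof. exact: gmulf1. Qed.

Lemma parabolicM S x y : parabolic S x -> parabolic S y -> parabolic S (x * y).
Proof. by rewrite /parabolic /= => Sx Sy; rewrite gmulfM /= Sx Sy. Qed.

Lemma parabolicV S x : parabolic S x -> parabolic S x^-1.
Proof. by rewrite /parabolic /= => Sx; rewrite gmulfV /= Sx. Qed.

Lemma parabolic_retr S x : parabolic S (retr S x).
Proof. by rewrite /parabolic /= retr_retr setIid. Qed.

(** * An action on reduced words, and the centralizer of a generator *)

Definition link v : set Gamma := [set u | adj u v /\ u <> v].

(* Extends an action of [G] on [Y], with [y0] fixed by the link of [v], to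
   reduced words over [Y], with [v] acting by multiplication by the letter [y0].
   Conjugation on [G] yields freeness of the conjugates of [v], and translation
   of subsets of [G] yields the centralizer of [v]. *)
Section WordAction.
Variables (v : Gamma) (Y : eqType) (a : G -> Y -> Y) (y0 : Y).
Hypothesis aM : forall x y t, a (x * y) t = a x (a y t).
Hypothesis a1 : forall t, a 1 t = t.
Hypothesis a_y0 : forall u, link v u -> a (gen u) y0 = y0.

Let aK x : cancel (a x) (a x^-1).
Proof. by move=> t; rewrite -aM mulVg a1. Qed.

Let lact (l : Gamma * bool) (m : word Y) :=
  if `[< l.1 = v >] then push (y0, l.2) m else map (lmap (a (sgen l.1 l.2))) m.

Let wact (w : word Gamma) m := foldr lact m w.

Let lact_reduced l m : reduced m -> reduced (lact l m).
Proof.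
rewrite /lact; case: ifP => _; first exact: reduced_push.
by rewrite lmap_reduced //; apply: can_inj (aK _).
Qed.

Let wact_reduced w m : reduced m -> reduced (wact w m).
Proof. by move=> rm; elim: w => //= l w; apply: lact_reduced. Qed.

Let lmap_aM x y m :
  map (lmap (a (x * y))) m = map (lmap (a x)) (map (lmap (a y)) m).
Proof. by rewrite -map_comp; apply: eq_map => -[t b]; rewrite /lmap /= aM. Qed.

Let lmap_a1 m : map (lmap (a 1)) m = m.
Proof. by rewrite -[RHS]map_id; apply: eq_map => -[t b]; rewrite /lmap /= a1. Qed.

(** Cancellation at [v] is [pushK], hence the restriction to reduced words; commutation of [v] with
    a neighbour holds because that neighbour fixes the letter [y0]. *)
Let wact_eq w w' m : pres_eq (@commutation_relator Gamma) w w' -> reduced m ->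
  wact w m = wact w' m.
Proof.
move=> ww'; elim: ww' m => {w w'} //.
- by move=> u w _ IH m rm; rewrite IH.
- by move=> u w w' _ IH _ IH' m rm; rewrite IH // IH'.
- move=> u u' w w' _ IH _ IH' m rm; rewrite /wact !foldr_cat -!/(wact _ _).
  by rewrite IH' // IH //; apply: wact_reduced.
- move=> u b m rm; rewrite /= /lact /=; case: asboolP => _.
    have -> : (y0, b) = linv (y0, ~~ b) by rewrite /linv /= negbK.
    exact: pushK.
  by rewrite -lmap_aM sgenN lmap_a1.
- move=> _ _ [s t st] m rm; rewrite /= /lact /=.
  case: asboolP => [Es|ns]; case: asboolP => [Et|nt] //.
  + rewrite lmap_push; last exact: can_inj (aK _).
    rewrite /lmap /= a_y0 //; split=> //.
    by apply: adj_sym; rewrite -Es.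
  + rewrite lmap_push; last exact: can_inj (aK _).
    by rewrite /lmap /= a_y0 //; split=> //; rewrite -Et.
  by rewrite -!lmap_aM gen_comm.
Qed.

Lemma word_action : exists act : G -> word Y -> word Y,
  [/\ forall x m, reduced m -> reduced (act x m),
      forall x y m, reduced m -> act (x * y) m = act x (act y m),
      forall b m, reduced m -> act (sgen v b) m = push (y0, b) m
    & forall h m, parabolic [set~ v] h -> reduced m ->
        act h m = map (lmap (a h)) m].
Proof.
pose act (x : G) m := wact (repr x) m.
have actE w m : reduced m -> act (pres_class _ w) m = wact w m.
  by move=> rm; apply: wact_eq => //; apply: pres_eq_repr.
have act_red x m : reduced m -> reduced (act x m) by apply: wact_reduced.
have actM x y m : reduced m -> act (x * y) m = act x (act y m).
  move=> rm; have [w ->] := pres_class_surj x; have [w' ->] := pres_class_surj y.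
  rewrite pres_classM !actE //; last exact: wact_reduced.
  by rewrite /wact foldr_cat.
have act_sgen u b m : reduced m -> act (sgen u b) m = lact (u, b) m.
  move=> rm; have -> : sgen u b = pres_class _ [:: (u, b)].
    by rewrite -eval_gen /eval_word big_cons big_nil mulg1.
  by rewrite actE.
exists act; split=> // [b m rm|h m Hh rm].
  by rewrite act_sgen // /lact asboolT.
(* With [h] written as its own retraction, the induction can range over all of [G]: the letters
   equal to [v] disappear. *)
rewrite -Hh; elim/graph_group_ind: h {Hh} => [|u b h IHh].
  by rewrite gmulf1 lmap_a1 (actE [::]).
rewrite gmulfM /= retr_sgen; case: asboolP => [nu|_]; last by rewrite mul1g.
rewrite actM // act_sgen; last exact: act_red.
by rewrite /lact asboolF //= IHh lmap_aM.
Qed.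

End WordAction.

(** Let [G] translate its subsets and take for [y0] the subgroup L generated by the link. On the
    empty word, [x * gen v] produces the letter xL and [gen v * x] produces L. Hence xL = L, which
    contains [x]. *)
Lemma centralizer_gen v x : parabolic [set~ v] x -> commute x (gen v) ->
  parabolic (link v) x.
Proof.
move=> Hx xv; pose a (x : G) (A : set G) : set G := [set y | A (x^-1 * y)].
have aM y z A : a (y * z) A = a y (a z A).
  by apply/seteqP; split => t /=; rewrite /a /= invgM mulgA.
have a1 A : a 1 A = A by apply/seteqP; split => t /=; rewrite /a /= invg1 mul1g.
have aK u : link v u -> a (gen u) (parabolic (link v)) = parabolic (link v).
  move=> Lu; have Pu : parabolic (link v) (gen u).
    by rewrite /parabolic /= retr_gen asboolT.
  apply/seteqP; split => t; rewrite /a /= => Pt.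
    by rewrite -(mulVKg (gen u) t); apply: parabolicM.
  by apply: parabolicM => //; apply: parabolicV.
have [act [act_red actM act_v act_H]] := word_action aM a1 aK.
have : act (x * gen v) [::] = act (gen v * x) [::] by rewrite xv.
rewrite !actM // (act_v false) // !(act_H x) // (act_v false) //= => -[ax].
have : a x (parabolic (link v)) x by rewrite /a /= mulVg; apply: parabolic1.
by rewrite ax.
Qed.

(** * Evaluation of words whose letters are group elements *)

Definition ev (s : word G) : G := eval_word id s.
Definition lev (l : G * bool) : G := if l.2 then l.1^-1 else l.1.

Lemma ev_nil : ev [::] = 1.
Proof. exact: big_nil. Qed.

Lemma ev_cons l s : ev (l :: s) = lev l * ev s.
Proof. exact: big_cons. Qed.

Lemma ev_cat s t : ev (s ++ t) = ev s * ev t.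
Proof. exact: big_cat. Qed.

Lemma ev1 l : ev [:: l] = lev l.
Proof. by rewrite ev_cons ev_nil mulg1. Qed.

Lemma lev_linv l : lev (linv l) = (lev l)^-1.
Proof. by case: l => x [] /=; rewrite /lev /= ?invgK. Qed.

Lemma ev_inv_word s : ev (inv_word s) = (ev s)^-1.
Proof.
elim: s => [|l s IHs]; first by rewrite ev_nil invg1.
by rewrite inv_word_cons -cats1 ev_cat IHs ev1 ev_cons invgM lev_linv.
Qed.

Lemma ev_conj k s : ev (map (lmap (conjg^~ k)) s) = ev s ^ k.
Proof.
elim: s => [|l s IHs]; first by rewrite ev_nil conj1g.
rewrite /= !ev_cons IHs conjMg; congr (_ * _).
by case: l => x []; rewrite /lev /= ?conjVg.
Qed.

(** * The free kernel of removing a vertex, and translations of an axis *)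

Section Conjugates.
Variable v : Gamma.

Definition gen_conj : set G :=
  [set x | exists2 k, parabolic [set~ v] k & x = gen v ^ k].

Definition rword (s : word G) := reduced s && all (fun l => l.1 \in gen_conj) s.

Lemma gen_conjJ k x : parabolic [set~ v] k -> x \in gen_conj -> x ^ k \in gen_conj.
Proof.
move=> Hk; rewrite !inE => -[h Hh ->]; exists (h * k); first exact: parabolicM.
by rewrite conjgM.
Qed.

Lemma rword_conj k s : parabolic [set~ v] k -> rword s ->
  rword (map (lmap (conjg^~ k)) s).
Proof.
move=> Hk /andP[rs Xs]; rewrite /rword lmap_reduced; last exact: conjg_inj.
rewrite rs /= all_map; apply: sub_all Xs => -[x b] /=; exact: gen_conjJ.
Qed.

(** Freeness of the conjugates of [v]: for the word action built from conjugation with [y0 = gen v],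
    the element [ev s] sends the empty word to [s], so [s] can be recovered from it. *)
Lemma ev_inj s t : rword s -> rword t -> ev s = ev t -> s = t.
Proof.
pose a (h x : G) := x ^ h^-1.
have aM x y t' : a (x * y) t' = a x (a y t') by rewrite /a invgM conjgM.
have a1 t' : a 1 t' = t' by rewrite /a invg1 conjg1.
have av u : link v u -> a (gen u) (gen v) = gen v.
  move=> [uv _]; apply/(conjg_fixP); apply/commgP; apply: commute_sym.
  by apply: commute_sym; apply: commuteV; apply/commute_sym/gen_comm.
have [act [act_red actM act_v act_H]] := word_action aM a1 av.
have actE s' : rword s' -> act (ev s') [::] = s'.
  elim: s' => [|[x b] s' IHs'].
    by rewrite ev_nil act_H //; apply: parabolic1.
  rewrite /rword /= => /andP[rs /andP[]]; rewrite inE => -[k Hk Ex] Xs.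
  have rs' : rword s' by apply/andP; split=> //; apply: path_sorted rs.
  have {Xs} /andP[rds' _] := rs'.
  (* In this form the action conjugates the tail by [k], pushes the letter [v], and conjugates
     back. *)
  have -> : ev ((x, b) :: s') = k^-1 * (sgen v b * (k * ev s')).
    rewrite ev_cons Ex /lev /= /sgen.
    by case: b {rs}; rewrite -?conjVg conjgE !mulgA ?mulgK.
  rewrite actM // actM ?act_red // actM // IHs' //.
  rewrite (act_H k) // act_v; last by rewrite -(act_H k) // act_red.
  have Hk' := parabolicV Hk.
  rewrite act_H //; last by rewrite reduced_push // -(act_H k) // act_red.
  have inja h : injective (a h) by apply: conjg_inj.
  rewrite lmap_push // -map_comp map_id_in.
    by rewrite /lmap /a /= invgK -Ex push_cons.
  by move=> [t' c] _; rewrite /lmap /a /= invgK conjgKV.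
by move=> rs rt E; rewrite -(actE s) // E actE.
Qed.

Lemma rword_catl s t : rword (s ++ t) -> rword s.
Proof. by rewrite /rword all_cat => /andP[/reduced_catl-> /andP[-> _]]. Qed.

Lemma rword_catr s t : rword (s ++ t) -> rword t.
Proof. by rewrite /rword all_cat => /andP[/reduced_catr-> /andP[_ ->]]. Qed.

Lemma rword_push l s : l.1 \in gen_conj -> rword s -> rword (push l s).
Proof.
move=> Xl /andP[rs Xs]; rewrite /rword reduced_push //=.
case: s Xs {rs} => /= [|l' s Xs]; first by rewrite Xl.
by case: ifP => _; rewrite /= ?Xl //; case/andP: Xs.
Qed.

Lemma ev_push l s : ev (push l s) = lev l * ev s.
Proof.
case: s => [|l' s] /=; first by rewrite ev_cons.
case: eqP => [->|_]; last by rewrite ev_cons.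
by rewrite ev_cons lev_linv mulVKg.
Qed.

(** The semidirect splitting of [G]: a new letter [v] is pushed onto the word, and any other letter
    moves past the word by conjugating its entries. *)
Lemma ev_decomp x :
  exists2 s, rword s & x = ev s * retr [set~ v] x.
Proof.
elim/graph_group_ind: x => [|u b x [s rs Es]].
  by exists [::]; rewrite // ev_nil mul1g gmulf1.
have [Eu|nu] := pselect (u = v).
  have Xv : gen v \in gen_conj.
    by rewrite inE; exists 1; rewrite ?conjg1 //; apply: parabolic1.
  exists (push (gen v, b) s); first exact: rword_push.
  rewrite ev_push gmulfM /= retr_sgen asboolF; last by rewrite /= Eu.
  by rewrite mul1g -mulgA -Es Eu.
have Hu : retr [set~ v] (sgen u b) = sgen u b by rewrite retr_sgen asboolT.
exists (map (lmap (conjg^~ (sgen u b)^-1)) s).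
  by apply: rword_conj => //; apply: parabolicV.
rewrite gmulfM /= Hu ev_conj conjgE invgK !mulgA mulgVK.
by rewrite {1}Es mulgA.
Qed.

Lemma rword_cancel s t : rword s -> rword t ->
  exists u c w, [/\ s = u ++ c, t = inv_word c ++ w & rword (u ++ w)].
Proof.
move=> /andP[rs Xs] /andP[rt Xt].
have [u [c [w [Es Et ruw]]]] := reduced_cancel rs rt.
exists u, c, w; split=> //; move: Xs Xt; rewrite Es Et /rword ruw !all_cat.
by move=> /andP[-> _] /andP[_ ->].
Qed.

Lemma rword_mul s t : rword s -> rword t -> exists r, [/\ rword r,
  ev r = ev s * ev t, size s <= size r + size t & size t <= size r + size s].
Proof.
move=> rs rt; have [u [c [w [-> -> ruw]]]] := rword_cancel rs rt.
have Sc : size (inv_word c) = size c := size_inv_word _.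
exists (u ++ w); split=> //; first by rewrite !ev_cat ev_inv_word mulgA mulgK.
  by rewrite !size_cat Sc; lia.
by rewrite !size_cat Sc; lia.
Qed.

(* A cyclically reduced word has reduced powers; otherwise conjugate. *)
Lemma long_power s n : rword s -> s != [::] ->
  exists k r, [/\ rword r, ev r = ev s ^+ k & n <= size r].
Proof.
have [m] := ubnP (size s); elim: m s n => // m IHm [//|l s] n /= le_s_m rs _.
have /andP[reds /andP[Xl Xs]] := rs.
have [El|nl] := eqVneq (linv l) (last l s).
  case/lastP: s El le_s_m rs reds {Xs} => [|s l'] /=.
    by case: l {Xl} => x [].
  rewrite last_rcons size_rcons => <-{l'} le_s_m rs reds.
  have rs' : rword s.
    by apply: (@rword_catl _ [:: linv l]); rewrite cats1; apply: (@rword_catr [:: l]).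
  have s0 : s != [::].
    by apply: contraTneq reds => ->; rewrite /reduced /= eqxx.
  (* Restoring the two outer letters can cancel at most one letter each, whence [n.+2]. *)
  have [|k [r [rr Er le_r]]] := IHm s n.+2 _ rs' s0; first exact: ltnW.
  have r1 l' : l'.1 \in gen_conj -> rword [:: l'] by rewrite /rword /= => ->.
  have [r2 [rr2 Er2 _ sz2]] := rword_mul (r1 l Xl) rr.
  have [r3 [rr3 Er3 sz3 _]] := rword_mul rr2 (r1 (linv l) Xl).
  exists k, r3; split=> //; last by move: le_r sz2 sz3 => /=; lia.
  have -> : ev (l :: rcons s (linv l)) = ev s ^ (lev l)^-1.
    by rewrite ev_cons -cats1 ev_cat ev1 lev_linv conjgE invgK.
  by rewrite Er3 Er2 Er !ev1 lev_linv -conjXg conjgE invgK mulgA.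
exists n, (flatten (nseq n (l :: s))); split.
- elim: n => // n /andP[IHr IHX].
  have -> : flatten (nseq n.+1 (l :: s)) = (l :: s) ++ flatten (nseq n (l :: s)) by [].
  apply/andP; split; last by rewrite all_cat IHX andbT; case/andP: rs.
  rewrite /reduced /= cat_path; apply/andP; split; first exact: reds.
  case: n IHr {IHX} => //= n IHr; apply/andP; split=> //.
  by apply: contraNneq nl => El; rewrite {1}El linvK.
- by elim: n => [|n IHn]; rewrite ?ev_nil //= -cat_cons ev_cat IHn expgS.
by elim: n => //= n IHn; rewrite size_cat; lia.
Qed.

(* The prefixes of [s] are vertices of the axis of [ev s]; modulo the stabilizer
   of the base vertex, [b] shifts them by [j - i].  Comparing the reduced forms
   of the two sides of [ev s * b = b * ev s] gives the shift. *)
Lemma axis_translation s u b h : rword s -> rword u -> parabolic [set~ v] h ->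
  b = ev u * h -> commute (ev s) b ->
  exists i j, [/\ i <= size u, j <= size u &
    forall n, n + (size u).*2 <= size s ->
      b * ev (take (i + n) s) = ev (take (j + n) s) * h].
Proof.
move=> rs ru Hh Eb sb; pose s' := map (lmap (conjg^~ h^-1)) s.
have rs' : rword s' by apply: rword_conj => //; apply: parabolicV.
have Es' w : ev (map (lmap (conjg^~ h^-1)) w) * h = h * ev w.
  by rewrite ev_conj conjgE invgK mulgA mulgVK.
(* Reduce both [ev s * ev u] and [ev u * ev s']; by freeness the two reduced words coincide. *)
have [p [q [u2 [Es Eu rp]]]] := rword_cancel rs ru.
have [u1 [q' [p' [Eu' Eq rp']]]] := rword_cancel ru rs'.
have E : p ++ u2 = u1 ++ p'.
  apply: ev_inj rp rp' _; apply: (mulIg h).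
  transitivity (ev s * b); last first.
    rewrite sb Eb -mulgA -Es' mulgA; congr (_ * _).
    by rewrite -/s' Eq Eu' !ev_cat ev_inv_word mulgA mulgK.
  by rewrite Eb Eu Es !ev_cat ev_inv_word !mulgA mulgK.
have Sq : size (inv_word q) = size q := size_inv_word _.
have Sq' : size (inv_word q') = size q' := size_inv_word _.
have Ss := congr1 size Es; have Su := congr1 size Eu.
have Su' := congr1 size Eu'; have Ss' := congr1 size Eq.
rewrite !size_cat in Ss Su Su' Ss'.
(* [i] counts the letters of [s'] cancelled by [u], and [j] the letters of [u] that survive. The
   bound on [n] keeps the prefix of [s] inside [p], away from the cancelled end [q]. *)
exists (size q'), (size u1); split=> [||n le_n]; try by lia.
have -> : take (size u1 + n) s = u1 ++ take n p'.
  rewrite Es takel_cat; last by lia.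
  have -> : take (size u1 + n) p = take (size u1 + n) (p ++ u2).
    by rewrite takel_cat //; lia.
  by rewrite E take_cat ifN ?addKn // -leqNgt leq_addr.
rewrite Eb -mulgA -Es' map_take -/s' Eq take_cat Sq' ifN -?leqNgt ?leq_addr //.
by rewrite addKn Eu' !ev_cat ev_inv_word !mulgA mulgK.
Qed.

(** A power of [g] has a long reduced word, whose prefixes [b] and [d] shift. Their commutator
    therefore fixes two consecutive prefixes, so up to conjugation it centralizes the letter between
    them, a conjugate of [v]. *)
Lemma commutator_in_link g b d : retr [set~ v] g = 1 -> g <> 1 ->
  commute g b -> commute g d ->
  exists y, parabolic (link v) ([~ b, d] ^ y).
Proof.
move=> g0 g1 gb gd.
have [s0 rs0 Eg] := ev_decomp g; rewrite g0 mulg1 in Eg.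
have s0N : s0 != [::] by apply/eqP => s0N; apply: g1; rewrite Eg s0N ev_nil.
have [ub rub Eb] := ev_decomp b; have [ud rud Ed] := ev_decomp d.
set hb := retr _ b in Eb; set hd := retr _ d in Ed.
have Hb : parabolic [set~ v] hb := parabolic_retr _ _.
have Hd : parabolic [set~ v] hd := parabolic_retr _ _.
(* The length leaves room for both shifts, the margins of [axis_translation], and one further
   letter. *)
have [k [s [rs Es le_s]]] := long_power (size ub + size ud).*2.+1 rs0 s0N.
have sg x : commute g x -> commute (ev s) x.
  by move=> gx; rewrite Es -Eg; apply/commute_sym/commuteX/commute_sym.
have [i [j [le_i le_j Tb]]] := axis_translation rs rub Hb Eb (sg _ gb).
have [i' [j' [le_i' le_j' Td]]] := axis_translation rs rud Hd Ed (sg _ gd).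
pose p n := ev (take n s).
(* Apply [d], [b], [d^-1], [b^-1] in turn to the prefix: the shifts cancel and only the stabilizer
   parts [hb], [hd] accumulate. *)
have fix_p n : n <= 1 -> [~ b, d] * p (i + i' + n) = p (i + i' + n) * [~ hb, hd].
  move=> le_n.
  have Tb1 := Tb (j' + n) ltac:(lia); have Tb2 := Tb (i' + n) ltac:(lia).
  have Td1 := Td (i + n) ltac:(lia); have Td2 := Td (j + n) ltac:(lia).
  rewrite -!/(p _) in Tb1 Tb2 Td1 Td2.
  have -> : [~ b, d] = b^-1 * d^-1 * b * d by rewrite commgEl conjgE !mulgA.
  have -> : [~ hb, hd] = hb^-1 * hd^-1 * hb * hd by rewrite commgEl conjgE !mulgA.
  have -> : (i + i' + n = i' + (i + n))%N by lia.
  rewrite -(mulgA _ d) Td1 (_ : j' + (i + n) = i + (j' + n))%N; last by lia.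
  rewrite mulgA -(mulgA _ b) Tb1 (_ : j + (j' + n) = j' + (j + n))%N; last by lia.
  have {}Td2 : d^-1 * p (j' + (j + n))%N = p (i' + (j + n))%N / hd.
    by apply: (mulgI d); rewrite mulVKg mulgA Td2 mulgK.
  have {}Tb2 : b^-1 * p (j + (i' + n))%N = p (i + (i' + n))%N / hb.
    by apply: (mulgI b); rewrite mulVKg mulgA Tb2 mulgK.
  rewrite !mulgA -(mulgA _ d^-1) Td2 (_ : i' + (j + n) = j + (i' + n))%N; last by lia.
  by rewrite !mulgA Tb2 (_ : i + (i' + n) = i' + (i + n))%N //; lia.
have lt_z : i + i' < size s by lia.
have [l [Xl El]] : exists l : G * bool, l.1 \in gen_conj /\
    p (i + i' + 1) = p (i + i' + 0) * lev l.
  case: s rs lt_z @p {Es le_s sg Tb Td fix_p} => // l0 s rs lt_z p.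
  exists (nth l0 (l0 :: s) (i + i')); split.
    by case/andP: rs => _ /allP; apply; apply: mem_nth.
  by rewrite /p addn0 addn1 (take_nth l0) // -cats1 ev_cat ev1.
have He : parabolic [set~ v] [~ hb, hd]
  by rewrite /parabolic /= gmulfR /= Hb Hd.
move: [~ hb, hd] He fix_p => e He fix_p.
(* Compare the cases [n = 0] and [n = 1]. *)
have el : commute e (lev l).
  have := fix_p 1%N isT; rewrite El mulgA (fix_p 0) // -!mulgA.
  by move/mulgI.
have ex : commute e l.1.
  move: el; case: (l) => x [] //=; rewrite /lev /= => /commuteV.
  by rewrite invgK.
move: Xl; rewrite inE => -[m Hm Elm].
exists (p (i + i' + 0) * m^-1).
rewrite conjgM [_ ^ p _]conjgE fix_p // mulKg; apply: centralizer_gen.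
  by rewrite /parabolic /= gmulfJ /= He (parabolicV Hm).
by rewrite -[gen v](conjgK m) -Elm /commute -!conjMg ex.
Qed.

End Conjugates.

(** * Conjugacy under retractions, and minimal vertex sets *)

Lemma retrT x : retr setT x = x.
Proof. by have [s /retr_sub] := finite_support x; apply. Qed.

(** [retr T] fixes [x ^ y], so applying it to [x = (x ^ y) ^ y^-1] only changes the conjugator. *)
Lemma retr_conj_of_parabolic S T x y : S `<=` T -> parabolic S (x ^ y) ->
  exists z, retr T x = x ^ z.
Proof.
move=> ST Sxy; exists (y * retr T y^-1).
by rewrite conjgM -{1}(conjgK y x) gmulfJ /= (retr_sub ST Sxy).
Qed.

(** Vertices are removed one at a time; each removal sends the conjugate already obtained to a
    conjugate of the image of [x]. *)
Lemma retr_conj_remove (s : seq Gamma) (V : set Gamma) x :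
  (forall v, List.In v s -> V v -> exists z, retr [set~ v] x = x ^ z) ->
  exists z, retr [set u | ~ (List.In u s /\ V u)] x = x ^ z.
Proof.
elim: s => [|v s IHs] Hs.
  exists 1; rewrite conjg1; apply: retr_sub (retrT x) => u _ /=; tauto.
have [|z Ez] := IHs; first by move=> u su; apply: Hs; right.
have [Vv|nVv] := pselect (V v); last first.
  exists z; rewrite -Ez; congr (retr _ x); apply/seteqP; split=> u /= nu.
    by move=> [su Vu]; apply: nu; split=> //; right.
  by move=> [[<-//|su] Vu]; apply: nu.
have [|z' Ez'] := Hs v _ Vv; first by left.
exists (z' * retr [set~ v] z); rewrite conjgM -Ez' -gmulfJ /= -Ez retr_retr.
congr (retr _ x); apply/seteqP; split=> u /=.
  move=> nu; split=> [Eu|[su Vu]]; apply: nu; first by rewrite Eu; split; [left|].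
  by split=> //; right.
by move=> [nu nsu] [[Ev|su] Vu]; [apply: nu | apply: nsu].
Qed.

(** Greedy descent along [s]: drop [v] if both images stay nontrivial. Otherwise removing [v] kills
    one of them, and by [shrink] this persists for all smaller sets. *)
Lemma retr_minimal (s : seq Gamma) S x y : retr S x <> 1 -> retr S y <> 1 ->
  exists T, [/\ T `<=` S, retr T x <> 1, retr T y <> 1 &
    forall v, List.In v s -> T v ->
      retr [set~ v] (retr T x) = 1 \/ retr [set~ v] (retr T y) = 1].
Proof.
elim: s S => [|v s IHs] S Sx Sy; first by exists S; split.
have shrink U T z : T `<=` U -> retr ([set~ v] `&` U) z = 1 ->
    retr [set~ v] (retr T z) = 1.
  move=> TU Uz; have -> : retr T z = retr T (retr U z).
    by rewrite retr_retr (setIidl TU).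
  by rewrite retr_retr setIC -retr_retr (retr_retr [set~ v] U) Uz gmulf1.
have [[Svx Svy]|] :=
    pselect (retr ([set~ v] `&` S) x <> 1 /\ retr ([set~ v] `&` S) y <> 1).
  have [T [TS Tx Ty HT]] := IHs _ Svx Svy; exists T; split=> //.
    by move=> u /TS[].
  by move=> u [<- /TS[/(_ erefl)]|]; last exact: HT.
move=> /not_andP nS; have [T [TS Tx Ty HT]] := IHs _ Sx Sy; exists T; split=> //.
move=> u [<- _|]; last exact: HT.
by case: nS => /contrapT /(shrink _ _ _ TS); [left|right].
Qed.

Lemma retr_commute S x y : (forall u v, S u -> S v -> adj u v) ->
  commute (retr S x) (retr S y).
Proof.
move=> clS; suff gC u b : S u -> commute (sgen u b) (retr S y).
  elim/graph_group_ind: x => [|u b x IHx]; first by rewrite gmulf1; apply/commute_sym/commute1.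
  rewrite gmulfM /= retr_sgen; case: asboolP => [Su|_]; last by rewrite mul1g.
  by apply/commute_sym; apply: commuteM; apply/commute_sym => //; apply: gC.
move=> Su; elim/graph_group_ind: y => [|v c y IHy]; first by rewrite gmulf1; apply: commute1.
rewrite gmulfM /= retr_sgen; case: asboolP => [Sv|_]; last by rewrite mul1g.
apply: commuteM => //; have uv := gen_comm (clS _ _ Su Sv).
have uvc : commute (gen u) (sgen v c) by case: c => //=; apply: commuteV.
by case: (b) => //=; apply/commute_sym/commuteV/commute_sym.
Qed.

(** * Vertices whose removal kills one of the two commutators *)

Section CommutingPairs.
Variables (s : seq Gamma) (T : set Gamma) (a b c d : G).
Hypothesis Ts : forall u, T u -> List.In u s.
Hypothesis abC : commute a b.
Hypothesis adC : commute a d.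
Hypothesis cbC : commute c b.
Hypothesis cdC : commute c d.
Hypothesis acN : [~ a, c] <> 1.
Hypothesis bdN : [~ b, d] <> 1.
Hypothesis Tb : parabolic T b.
Hypothesis Td : parabolic T d.

Lemma commutator_retr_conj v S : retr [set~ v] [~ a, c] = 1 -> link v `<=` S ->
  exists z, retr S [~ b, d] = [~ b, d] ^ z.
Proof.
have gC x : commute a x -> commute c x -> commute [~ a, c] x.
  move=> /commute_sym ax /commute_sym cx; rewrite commgEl conjgE; apply: commute_sym.
  by do ?[apply: commuteM]; rewrite //; apply: commuteV.
move=> gv vS; have [y Hy] := commutator_in_link gv acN (gC b abC cbC) (gC d adC cdC).
exact: retr_conj_of_parabolic vS Hy.
Qed.

(** If [v] and [w] were not adjacent, the link of [v] would avoid [w], so retracting onto it would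
    kill [[~ b, d]]; but that image is a conjugate of [[~ b, d]]. *)
Lemma killing_adj v w : retr [set~ v] [~ a, c] = 1 ->
  retr [set~ w] [~ b, d] = 1 -> adj v w.
Proof.
move=> gv hw; apply: contrapT => nvw.
have [z] := commutator_retr_conj gv (@subset_refl _ _).
have <- : retr (link v) (retr [set~ w] [~ b, d]) = retr (link v) [~ b, d].
  rewrite retr_retr (setIidl _) // => u [uv _] /= Eu; apply: nvw.
  by rewrite -Eu; apply: adj_sym.
by rewrite hw gmulf1 => /esym/eqP; rewrite conjg_eq1 => /eqP.
Qed.

(** Discard all vertices killing [[~ a, c]]: [[~ b, d]] becomes a conjugate of itself, and the
    vertices left all kill it. Were they pairwise adjacent, the images of [b] and [d] would
    commute. *)
Lemma killing_nonadj :
  (forall v, T v -> retr [set~ v] [~ a, c] = 1 \/ retr [set~ v] [~ b, d] = 1) ->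
  exists z w, [/\ retr [set~ z] [~ b, d] = 1, retr [set~ w] [~ b, d] = 1 &
    ~ adj z w].
Proof.
move=> cov; pose V := [set v | retr [set~ v] [~ a, c] = 1].
pose S := [set u | ~ (List.In u s /\ V u)] `&` T.
have [] := @retr_conj_remove s V [~ b, d].
  by move=> v _ gv; apply: (commutator_retr_conj gv) => u [].
move=> z Ez; apply: contrapT => noadj.
have ST u : S u -> retr [set~ u] [~ b, d] = 1.
  move=> [/= nu Tu]; case: (cov u Tu) => // gu; case: nu; split=> //.
  exact: Ts.
have : commute (retr S b) (retr S d).
  apply: retr_commute => u w Su Sw; apply: contrapT => nuw; apply: noadj.
  by exists u, w; split=> //; apply: ST.
rewrite -!retr_retr Tb Td => /commgP/eqP; rewrite -gmulfR /= Ez => /eqP.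
by rewrite conjg_eq1 => /eqP.
Qed.

End CommutingPairs.
End GraphGroup.

(** * Assembling the induced four-cycle *)

Lemma C4_adj_inj (i j : C4) : (forall l, adj i l <-> adj j l) -> i = j.
Proof.
pose e (i l : 'I_4) := [|| i == l, ordS i == l | ordS l == i].
move=> N; have {}N l : e i l = e j l by apply/idP/idP => /(N l).
apply: ord_inj; move: (N (@Ordinal 4 0 isT)) (N (@Ordinal 4 1 isT))
  (N (@Ordinal 4 2 isT)) (N (@Ordinal 4 3 isT)).
by case: i {N} => [[|[|[|[|i]]]] //] pi; case: j => [[|[|[|[|j]]]] //] pj.
Qed.

(** Injectivity of [k] is automatic, because distinct vertices of [C4] have distinct closed
    neighbourhoods. *)
Lemma C4_embedding (A : graph) (k : C4 -> A) :
  (forall i j : C4, adj i j <-> adj (k i) (k j)) ->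
  exists S : set A, graph_iso (induced S) C4.
Proof.
move=> kE; pose S := range k.
have k_inj : injective k.
  by move=> i j Ek; apply: C4_adj_inj => l; rewrite !kE Ek.
have kP (u : {x | S x}) : exists i, k i = sval u.
  by case: (svalP u) => i _ Ei; exists i.
pose f u := sval (cid (kP u)); have fK u : k (f u) = sval u := svalP (cid (kP u)).
exists S, f; last by move=> u v; rewrite kE !fK.
have Sk i : S (k i) by exists i.
exists (fun i => exist _ (k i) (Sk i)) => [u|i].
  by rewrite [RHS]sig_eta; apply: eq_exist; apply: fK.
by apply: k_inj; rewrite fK.
Qed.

Theorem theorem7 (Gamma : graph)
    (HGamma : ~ exists S : set Gamma, graph_iso (induced S) C4) :
  ~ satisfies_phi C4 (graph_group Gamma).
Proof.
move=> [sigma sigmaE]; apply: HGamma.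
pose o i (lt_i : i < 4) : C4 := Ordinal lt_i.
pose a := sigma (@o 0%N isT); pose b := sigma (@o 1%N isT).
pose c := sigma (@o 2%N isT); pose d := sigma (@o 3%N isT).
have abC : commute a b by apply/sigmaE.
have adC : commute a d by apply/sigmaE.
have cbC : commute c b by apply/sigmaE.
have cdC : commute c d by apply/sigmaE.
have acN : [~ a, c] <> 1 by move/eqP/commgP/sigmaE.
have bdN : [~ b, d] <> 1 by move/eqP/commgP/sigmaE.
have [s1 Es1] := finite_support [~ a, c].
have [s2 Es2] := finite_support [~ b, d].
pose s := s1 ++ s2; pose S := [set u | List.In u s].
have [||T [TS gT hT cov]] := @retr_minimal _ s S [~ a, c] [~ b, d].
- rewrite (retr_sub _ Es1) // => u; rewrite /S /= /s => su.
  by apply/List.in_app_iff; left.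
- rewrite (retr_sub _ Es2) // => u; rewrite /S /= /s => su.
  by apply/List.in_app_iff; right.
rewrite !gmulfR /= in gT hT cov.
have C x y : commute x y -> commute (retr T x) (retr T y) by apply: gmulf_commute.
have P x := @parabolic_retr Gamma T x.
have adjVW := killing_adj (C _ _ abC) (C _ _ adC) (C _ _ cbC) (C _ _ cdC) gT hT.
have [z [w [hz hw nzw]]] := killing_nonadj TS (C _ _ abC) (C _ _ adC)
  (C _ _ cbC) (C _ _ cdC) gT hT (P b) (P d) (fun v Tv => cov v (TS v Tv) Tv).
(* The pairs [(a, c)] and [(b, d)] now exchange roles. *)
have C' x y : commute x y -> commute (retr T y) (retr T x).
  by move=> xy; apply/commute_sym/C.
have [x [y [gx gy nxy]]] := killing_nonadj TS (C' _ _ abC) (C' _ _ cbC)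
  (C' _ _ adC) (C' _ _ cdC) hT gT (P a) (P c)
  (fun v Tv => iffLR (or_comm _ _) (cov v (TS v Tv) Tv)).
have [xz xw] := (adjVW _ _ gx hz, adjVW _ _ gx hw).
have [yz yw] := (adjVW _ _ gy hz, adjVW _ _ gy hw).
have [zx wx] := (adj_sym xz, adj_sym xw); have [zy wy] := (adj_sym yz, adj_sym yw).
have [nyx nwz] : ~ adj y x /\ ~ adj w z by split=> /adj_sym.
(* Vertices killing [[~ a, c]] alternate with those killing [[~ b, d]], so the nonadjacent pairs
   become the diagonals. *)
apply: (@C4_embedding _ (fun i : 'I_4 => nth x [:: x; z; y; w] i)).
move=> [[|[|[|[|i]]]] //] pi [[|[|[|[|j]]]] //] pj; split=> //= _; exact: adj_refl.
Qed.
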